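(* Let $w$ be a recurrent infinite word over $\Sigma=\{0,\dots,\sigma-1\}$ generated by a morphism $\phi$ with $\det A_\phi=\pm1$. Then $w$ satisfies the WELLDOC property if and only if the Parikh vectors of the returns to the first letter $w_0$ of $w$ generate $\mathbb{Z}^\sigma$ as an additive group.
   Context: A morphism $\phi:\Sigma^*\to\Sigma^*$ is nonerasing; $w$ is generated by $\phi$ if $\phi(a)=as$ for a letter $a$ and nonempty word $s$ and $w=\lim_n\phi^n(a)$. $A_\phi$ is the $\sigma\times\sigma$ matrix with entry $|\phi(i)|_j$ in row $j$, column $i$. The Parikh vector of a finite word $u$ is $V_u=(|u|_0,\dots,|u|_{\sigma-1})$. For a factor $u$ of $w$ occurring at positions $a_0<a_1<\dots$, $X_u=\{V_{w[0,a_i)}\}$ and $X_{u,m}$ is its reduction mod $m$; WELLDOC means $X_{u,m}=(\mathbb{Z}/m\mathbb{Z})^\sigma$ for all $m\ge1$ and all factors $u$. A return to $u$ is a factor $w[a_i,a_{i+1})$. Recurrent: every factor occurs infinitely often. *)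

(* Defs.v *)
From mathcomp Require Import all_boot all_algebra.

Set Implicit Arguments.
Unset Strict Implicit.
Unset Printing Implicit Defensive.

Import GRing.Theory.
Local Open Scope ring_scope.

Section Words.
Variable sigma : nat.
Local Notation letter := 'I_sigma.

(* Words over {0, ..., sigma - 1} are sequences of ordinals; an infinite word
   is a map nat -> letter.  [subword w i j] is w[i, j). *)
Definition subword (w : nat -> letter) (i j : nat) : seq letter :=
  [seq w k | k <- iota i (j - i)].

Definition occurs_at (w : nat -> letter) (u : seq letter) (i : nat) : Prop :=
  subword w i (i + size u) = u.

(* The empty word counts as a factor. *)
Definition factor (w : nat -> letter) (u : seq letter) : Prop :=
  exists i : nat, occurs_at w u i.

Definition recurrent (w : nat -> letter) : Prop :=
  forall u : seq letter, factor w u ->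
  forall N : nat, exists2 i : nat, (N <= i)%N & occurs_at w u i.

Definition nonerasing_morphism (phi : seq letter -> seq letter) : Prop :=
  {morph phi : u v / u ++ v} /\ (forall a : letter, phi [:: a] <> [::]).

(* Convergence for the prefix topology: for every k, the words x n eventually
   have length at least k and agree with w on their first k letters. *)
Definition word_limit (x : nat -> seq letter) (w : nat -> letter) : Prop :=
  forall k : nat, exists N : nat, forall n : nat, (N <= n)%N ->
  (k <= size (x n))%N /\ take k (x n) = subword w 0 k.

Definition generated_by (phi : seq letter -> seq letter) (w : nat -> letter) :
    Prop :=
  exists (a : letter) (s : seq letter),
    [/\ s <> [::], phi [:: a] = a :: s &
        word_limit (fun n => iter n phi [:: a]) w].

Definition parikh (u : seq letter) : 'cV[int]_sigma :=
  \col_j (count_mem j u)%:Z.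

Definition incidence_mx (phi : seq letter -> seq letter) : 'M[int]_sigma :=
  \matrix_(j, i) (count_mem j (phi [:: i]))%:Z.

Definition parikh_prefixes (w : nat -> letter) (u : seq letter)
    (v : 'cV[int]_sigma) : Prop :=
  exists2 i : nat, occurs_at w u i & v = parikh (subword w 0 i).

(* Z/mZ is represented by the residues 'I_m rather than by 'Z_m, because 'Z_1
   is not the trivial ring. *)
Definition parikh_prefixes_mod (w : nat -> letter) (u : seq letter) (m : nat)
    (r : 'cV['I_m]_sigma) : Prop :=
  exists2 v : 'cV[int]_sigma, parikh_prefixes w u v &
    forall j : letter, (v j ord0 = (r j ord0 : nat)%:Z %[mod m])%Z.

Definition welldoc (w : nat -> letter) : Prop :=
  forall (m : nat) (u : seq letter), (0 < m)%N -> factor w u ->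
  forall r : 'cV['I_m]_sigma, parikh_prefixes_mod w u r.

Definition return_to (w : nat -> letter) (u r : seq letter) : Prop :=
  exists i j : nat,
    [/\ (i < j)%N, occurs_at w u i, occurs_at w u j,
        (forall k : nat, (i < k < j)%N -> ~ occurs_at w u k) &
        r = subword w i j].

Definition return_parikh (w : nat -> letter) (u : seq letter)
    (v : 'cV[int]_sigma) : Prop :=
  exists2 r : seq letter, return_to w u r & v = parikh r.

End Words.

(* The subgroup generated by S, as the intersection of all subgroups
   containing S. *)
Definition subgroup_generated (V : zmodType) (S : V -> Prop) (v : V) : Prop :=
  forall H : V -> Prop,
    H 0 -> (forall x y : V, H x -> H y -> H (x - y)) ->
    (forall x : V, S x -> H x) -> H v.

Definition generates (V : zmodType) (S : V -> Prop) : Prop :=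
  forall v : V, subgroup_generated S v.

(* Main.v *)
(* Let [a = w 0], let [A] be the incidence matrix of [phi] and, for a factor
   [u], let [X_u] be the set of Parikh vectors of the prefixes preceding occurrences
   of [u].  If [u] occurs inside [phi^n (a)] after a prefix of vector [x], then
   [A^n v + x] is in [X_u] for all [v] in [X_a].  As [det A = +-1], the matrix
   [A] has finite order modulo [m], so that [X_a + X_u] is contained in [X_u]
   modulo [m].  In particular [X_a] is a subgroup modulo [m]; it contains the
   differences of its elements, hence the vectors of the returns to [a].
   Conversely, a subgroup of [Z^sigma] containing the vectors of the returns
   contains [X_a], so under WELLDOC it is onto modulo every [m], and a subgroup
   with this property is the whole of [Z^sigma]. *)
Require Import Defs.
From mathcomp Require Import all_boot all_algebra.
From mathcomp Require Import fingroup.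
Local Open Scope ring_scope.

Set Implicit Arguments.
Unset Strict Implicit.
Unset Printing Implicit Defensive.

Import GRing.Theory Num.Theory.

(** * Congruences of integer matrices modulo [m] *)

Lemma unit_expr_eq1 (R : finUnitRingType) (x : R) :
  x \is a GRing.unit -> exists2 k, (0 < k)%N & x ^+ k = 1.
Proof.
move=> ux; exists #[FinRing.Unit ux]%g; first exact: order_gt0.
by rewrite -(FinRing.val_unitX _ (FinRing.Unit ux)) expg_order.
Qed.

Lemma intr_Zp_eq0 m (x : int) :
  (1 < m)%N -> x%:~R = 0 :> 'Z_m -> (m %| x)%Z.
Proof.
move=> m1; suff natP n : n%:R = 0 :> 'Z_m -> (m %| n)%N.
  case: x => n; first exact: natP.
  by rewrite NegzE rmorphN dvdzE abszN => /eqP; rewrite oppr_eq0 => /eqP/natP.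
by move/(congr1 (@nat_of_ord _)); rewrite val_Zp_nat // => /eqP.
Qed.

(** The explicit quotient [Z] turns compatibility with sums and products into matrix identities, and
    no separate treatment of [m = 1] is needed. *)
Definition eqmodmx m p q (A B : 'M[int]_(p, q)) : Prop :=
  exists Z, A = B + m%:Z *: Z.

Lemma eqmodmxP m p q (A B : 'M[int]_(p, q)) :
  eqmodmx m A B <-> forall i j, (A i j = B i j %[mod m])%Z.
Proof.
split=> [[Z ->] i j|eqAB]; first by rewrite !mxE addrC mulrC modzMDl.
exists (\matrix_(i, j) ((A i j - B i j) %/ m)%Z).
apply/matrixP=> i j; rewrite !mxE mulrC divzK; first by rewrite addrC subrK.
by rewrite -eqz_mod_dvd; apply/eqP.
Qed.

Lemma eqmodmx_refl m p q (A : 'M[int]_(p, q)) : eqmodmx m A A.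
Proof. by apply/eqmodmxP. Qed.

Lemma eqmodmx_sym m p q (A B : 'M[int]_(p, q)) : eqmodmx m A B -> eqmodmx m B A.
Proof. by move/eqmodmxP=> eqAB; apply/eqmodmxP=> i j; rewrite eqAB. Qed.

Lemma eqmodmx_trans m p q (A B C : 'M[int]_(p, q)) :
  eqmodmx m A B -> eqmodmx m B C -> eqmodmx m A C.
Proof. by move=> [Y ->] [Z ->]; exists (Z + Y); rewrite -addrA scalerDr. Qed.

Lemma eqmodmxD m p q (A B A' B' : 'M[int]_(p, q)) :
  eqmodmx m A B -> eqmodmx m A' B' -> eqmodmx m (A + A') (B + B').
Proof. by move=> [Y ->] [Z ->]; exists (Y + Z); rewrite scalerDr addrACA. Qed.

Lemma eqmodmxM m p q r (A B : 'M[int]_(p, q)) (A' B' : 'M[int]_(q, r)) :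
  eqmodmx m A B -> eqmodmx m A' B' -> eqmodmx m (A *m A') (B *m B').
Proof.
move=> [Y ->] [Z ->]; exists (B *m Z + Y *m (B' + m%:Z *: Z)).
by rewrite mulmxDl mulmxDr -scalemxAl -scalemxAr -addrA scalerDr.
Qed.

(** The reduction of [A] is a unit of a finite matrix ring over ['Z_m], hence has finite order. Size
    0 and [m = 1] are set apart: there every congruence is trivial. *)
Lemma int_unit_mx_exp_eqmod1 n (A : 'M[int]_n) m :
  (0 < m)%N -> \det A = 1 \/ \det A = -1 ->
  exists2 k, (0 < k)%N & eqmodmx m (A ^+ k) 1.
Proof.
case: n A => [|n] A; first by exists 1%N => //; apply/eqmodmxP; case.
case: m => [|[|m]] // _ detA.
  by exists 1%N => //; apply/eqmodmxP => i j; rewrite !modz1.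
pose f := map_mx (intmul (1 : 'Z_m.+2)) : 'M[int]_n.+1 -> _.
have [|k k0 Ak] := @unit_expr_eq1 'M['Z_m.+2]_n.+1 (f A).
  by rewrite -[_ \is a _]/(_ \in unitmx) unitmxE det_map_mx; case: detA => ->;
    rewrite ?rmorphN rmorph1 ?unitrN unitr1.
exists k => //; apply/eqmodmxP => i j; apply/eqP; rewrite eqz_mod_dvd.
have /matrixP/(_ i j)/eqP : f (A ^+ k) = 1 by rewrite /f rmorphXn.
rewrite /f !mxE -subr_eq0 => /eqP eqAk; apply: intr_Zp_eq0 => //.
by rewrite rmorphB /= rmorph_nat eqAk.
Qed.

(** * Prefixes of words and the action of the morphism on Parikh vectors *)

Section Words.
Variable sigma : nat.
Implicit Types (w : nat -> 'I_sigma) (u v p : seq 'I_sigma).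

Definition prefix_of w u : Prop := subword w 0 (size u) = u.

Lemma size_subword w i j : size (subword w i j) = (j - i)%N.
Proof. by rewrite size_map size_iota. Qed.

Lemma subword_cat w i j k : (i <= j)%N -> (j <= k)%N ->
  subword w i k = subword w i j ++ subword w j k.
Proof.
move=> ij jk; rewrite /subword -map_cat -[in X in _ ++ X](subnKC ij) -iotaD.
by rewrite subnKC // addnC addnBA // subnK.
Qed.

Lemma prefix_of_cat w u v :
  prefix_of w (u ++ v) <-> prefix_of w u /\ occurs_at w v (size u).
Proof.
rewrite /prefix_of /occurs_at size_cat (@subword_cat _ _ (size u)) ?leq_addr //.
split=> [/eqP|[-> ->]//].
by rewrite eqseq_cat ?size_subword ?subn0 // => /andP[/eqP -> /eqP ->].
Qed.

Lemma prefix_of_subword w i : prefix_of w (subword w 0 i).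
Proof. by rewrite /prefix_of size_subword subn0. Qed.

(** Trades positions for prefixes, to which the morphism can be applied. *)
Lemma parikh_prefixesP w u x :
  parikh_prefixes w u x <-> exists2 p, prefix_of w (p ++ u) & x = parikh p.
Proof.
split=> [[i ui ->]|[p /prefix_of_cat[wp up] ->]].
  exists (subword w 0 i) => //; apply/prefix_of_cat.
  by rewrite size_subword subn0; split=> //; apply: prefix_of_subword.
by exists (size p); rewrite ?wp.
Qed.

Lemma parikh_cat u v : parikh (u ++ v) = parikh u + parikh v.
Proof. by apply/colP=> j; rewrite !mxE count_cat. Qed.

Lemma parikh_subword w i j : (i <= j)%N ->
  parikh (subword w i j) = parikh (subword w 0 j) - parikh (subword w 0 i).
Proof.
by move=> ij; rewrite (@subword_cat w 0 i j) // parikh_cat addrC addKr.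
Qed.

Lemma occurs_at1 w a i : occurs_at w [:: a] i <-> w i = a.
Proof.
by rewrite /occurs_at /subword addnC addnK /=; split=> [[]|->].
Qed.

Section Morphism.
Variable phi : seq 'I_sigma -> seq 'I_sigma.
Hypothesis phi_cat : {morph phi : u v / u ++ v}.

Lemma morphism_nil : phi [::] = [::].
Proof.
have /eqP := congr1 size (phi_cat [::] [::]).
by rewrite size_cat -{1}[size _]addn0 eqn_add2l eq_sym => /nilP.
Qed.

Lemma iter_morphism_cat n : {morph iter n phi : u v / u ++ v}.
Proof. by move=> u v; elim: n => //= n ->; rewrite phi_cat. Qed.

Lemma parikh_morphism u : parikh (phi u) = incidence_mx phi *m parikh u.
Proof.
elim: u => [|a u IHu].
  rewrite morphism_nil (_ : parikh [::] = 0) ?mulmx0 //.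
  by apply/colP=> j; rewrite !mxE.
rewrite -cat1s phi_cat !parikh_cat IHu mulmxDr; congr (_ + _).
apply/colP=> j; rewrite !mxE (bigD1 a) //= big1 ?addr0 => [|i /negPf neq_ia].
  by rewrite !mxE /= eqxx mulr1.
by rewrite !mxE /= eq_sym neq_ia mulr0.
Qed.

Lemma parikh_iter_morphism n u :
  parikh (iter n phi u) = incidence_mx phi ^+ n *m parikh u.
Proof.
elim: n => [|n IHn] /=; first by rewrite expr0 mul1mx.
by rewrite parikh_morphism IHn exprS mulmxA.
Qed.

Variable w : nat -> 'I_sigma.
Hypothesis w_gen : generated_by phi w.

(** As [phi [:: a]] starts with [a], each iterate is a prefix of all later ones, hence of the limit;
    the iterate of index 0 identifies [a] with [w 0]. *)
Lemma generated_by_head :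
  word_limit (fun n => iter n phi [:: w 0%N]) w /\
  forall n, prefix_of w (iter n phi [:: w 0%N]).
Proof.
have [a [s [_ phi_a lim_w]]] := w_gen.
have iter_prefix d k : prefix (iter k phi [:: a]) (iter (k + d) phi [:: a]).
  elim: d => [|d IHd]; first by rewrite addn0 prefix_refl.
  apply: prefix_trans IHd _; rewrite addnS iterSr phi_a -(cat1s a s).
  by rewrite iter_morphism_cat prefix_prefix.
have prefix_a k : prefix_of w (iter k phi [:: a]).
  have [N lim_N] := lim_w (size (iter k phi [:: a])).
  rewrite /prefix_of; have [_ <-] := lim_N (k + N)%N (leq_addl _ _).
  by have:= iter_prefix N k; rewrite prefixE => /eqP.
by have [->] : prefix_of w [:: a] := prefix_a 0%N.
Qed.

(** For large [n], the word [phi^n (w 0)] starts with [q ++ u]. If [p] precedes an occurrence of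
    [w 0], then [u] occurs after [phi^n (p) ++ q]. The bound [N] does not depend on [v]. *)
Lemma parikh_prefixes_iter u x : parikh_prefixes w u x ->
  exists N, forall n (v : 'cV[int]_sigma), (N <= n)%N ->
    parikh_prefixes w [:: w 0%N] v ->
    parikh_prefixes w u (incidence_mx phi ^+ n *m v + x).
Proof.
move=> /parikh_prefixesP[q wqu ->].
have [lim_w wprefix] := generated_by_head.
have [N lim_N] := lim_w (size (q ++ u)).
exists N => n v leNn /parikh_prefixesP[p wpa ->].
have [_] := lim_N n leNn; rewrite wqu => iter_qu.
apply/parikh_prefixesP; exists (iter n phi p ++ q); last first.
  by rewrite parikh_cat parikh_iter_morphism.
suff : prefix_of w (iter n phi (p ++ [:: w 0%N])).
  rewrite iter_morphism_cat.
  rewrite -(cat_take_drop (size (q ++ u)) (iter n phi [:: _])).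
  by rewrite iter_qu !catA => /prefix_of_cat[].
have [M /(_ _ (leqnn M))[_]] := lim_w (size (p ++ [:: w 0%N])).
rewrite wpa => iter_pa.
(* Since [p ++ [:: w 0]] is a prefix of [phi^M (w 0)], its image by [phi^n] is a prefix of
   [phi^(n + M) (w 0)]. *)
have := wprefix (n + M)%N; rewrite iterD.
rewrite -(cat_take_drop (size (p ++ [:: w 0%N])) (iter M phi _)) iter_pa.
by rewrite iter_morphism_cat => /prefix_of_cat[].
Qed.
End Morphism.
End Words.

(** * Subgroups, and density modulo every [m] *)

Section Subgroup.
Variables (V : zmodType) (H : V -> Prop).
Hypotheses (H0 : H 0) (HB : forall x y, H x -> H y -> H (x - y)).

Lemma subgroupN x : H x -> H (- x).
Proof. by move=> Hx; rewrite -sub0r; apply: HB. Qed.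

Lemma subgroupD x y : H x -> H y -> H (x + y).
Proof. by move=> Hx Hy; rewrite -[y]opprK; apply/HB/subgroupN. Qed.

Lemma subgroupMz x c : H x -> H (x *~ c).
Proof.
move=> Hx; have HMn k : H (x *+ k).
  by elim: k => [|k IHk]; rewrite ?mulr0n // mulrS; apply: subgroupD.
by case: c => k; rewrite ?NegzE -?pmulrn -?nmulrn //; apply: subgroupN.
Qed.

End Subgroup.

(* Modulo 2 the subgroup contains a basis, so lifting it to [H] gives a square
   matrix of nonzero determinant [D]; by the adjugate identity [H] contains all
   multiples of [D], and density modulo [D] concludes. *)
Lemma dense_subgroup_full n (H : 'cV[int]_n -> Prop) :
    H 0 -> (forall x y, H x -> H y -> H (x - y)) ->
    (forall m v, (0 < m)%N -> exists2 x, H x & eqmodmx m v x) ->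
  forall v, H v.
Proof.
move=> H0 HB denseH v.
have HD := subgroupD H0 HB; have HMz := subgroupMz H0 HB.
have [c Hc eqc] := fin_all_exists2 (fun i => denseH 2%N (delta_mx i 0) isT).
pose M := \matrix_(i, j) c j i 0.
have HM y : H (M *m y).
  rewrite (_ : M *m y = \sum_i c i *~ y i 0); last first.
    apply/colP=> i; rewrite !mxE summxE; apply: eq_bigr => j _.
    by rewrite -scaler_int !mxE intz mulrC.
  by apply: big_ind => // i _; apply: HMz.
have detM : \det M != 0.
  have /(congr1 (fun N => \det N)) : map_mx (intmul (1 : 'F_2)) M = 1%:M.
    apply/matrixP=> i j; rewrite !mxE.
    have [Z ->] := eqmodmx_sym (eqc j).
    rewrite !mxE andbT rmorphD rmorphM /=.
    have -> : 2%:Z%:~R = 0 :> 'F_2 by apply/eqP.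
    by rewrite mul0r addr0 rmorph_nat.
  by rewrite det1 det_map_mx; apply: contra_eqN => /eqP ->; rewrite rmorph0.
have [x Hx [z ->]] : exists2 x, H x & eqmodmx `|\det M| v x.
  by apply: denseH; rewrite absz_gt0.
apply: HD => //.
suff Hdet : H (\det M *: z).
  by rewrite abszE; case: ger0P => _ //; rewrite scaleNr; apply: subgroupN.
by rewrite -mul_scalar_mx -mul_mx_adj -mulmxA; apply: HM.
Qed.

(** * The two implications *)

Lemma welldoc_generates sigma (w : nat -> 'I_sigma) :
  welldoc w -> generates (return_parikh w [:: w 0%N]).
Proof.
move=> wd v H H0 HB returnsH.
apply: (dense_subgroup_full H0 HB _ v) => m {}v m0.
have HD := subgroupD H0 HB.
(* Strong induction: the prefix is cut at the last occurrence [j < i] of [w 0], and [subword w j i]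
   is a return. *)
have Hprefixes i : w i = w 0%N -> H (parikh (subword w 0 i)).
  elim/ltn_ind: i => i IHi wi.
  have [->|i0] := posnP i.
    by rewrite (_ : parikh _ = 0) //; apply/colP=> j; rewrite !mxE.
  have ex_j : exists j, (j < i)%N && (w j == w 0%N).
    by exists 0%N; rewrite i0 /=.
  case: (@ex_maxnP _ i ex_j) => [j /andP[/ltnW]//|j /andP[ji /eqP wj] max_j].
  rewrite (subword_cat w (leq0n j) (ltnW ji)) parikh_cat.
  apply: HD; first exact: IHi.
  apply: returnsH; exists (subword w j i) => //; exists j, i.
  split=> //; try exact/occurs_at1.
  move=> k /andP[jk ki] /occurs_at1 wk.
  by have := max_j k; rewrite ki wk eqxx leqNgt jk => /(_ isT).
have ltm j : (`|(v j ord0 %% m)%Z| < m)%N.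
  by rewrite -ltz_nat abszE ger0_norm ?modz_ge0 ?ltz_pmod ?lt0n_neq0 //= -lt0n.
have w0 : factor w [:: w 0%N] by exists 0%N.
have [x [i /occurs_at1 wi ->] eqx] :=
  wd m _ m0 w0 (\col_j Ordinal (ltm j)).
exists (parikh (subword w 0 i)); first exact: Hprefixes.
apply/eqmodmxP=> j k; rewrite !ord1 eqx mxE /= abszE ger0_norm ?modz_mod //.
by rewrite modz_ge0 // -lt0n.
Qed.

Lemma generates_welldoc sigma phi (w : nat -> 'I_sigma) :
    nonerasing_morphism phi -> generated_by phi w ->
    \det (incidence_mx phi) = 1 \/ \det (incidence_mx phi) = -1 ->
  generates (return_parikh w [:: w 0%N]) -> welldoc w.
Proof.
move=> [phi_cat _] w_gen det_phi gen m u m0 [i ui] r.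
have [k k0 Ak] := int_unit_mx_exp_eqmod1 m0 det_phi.
have Akn n : eqmodmx m (incidence_mx phi ^+ (k * n)) 1.
  elim: n => [|n IHn]; first by rewrite muln0; apply: eqmodmx_refl.
  by rewrite mulnS exprD -[1]mulr1; apply: eqmodmxM.
(* [X u'] is the saturation modulo [m] of the set of prefix vectors of [u']. *)
pose X u' v := exists2 x, parikh_prefixes w u' x & eqmodmx m v x.
have XD u' x v : X u' x -> X [:: w 0%N] v -> X u' (v + x).
  move=> [x' Xx' eqx] [v' Xv' eqv].
  have [N XN] := parikh_prefixes_iter phi_cat w_gen Xx'.
  exists (incidence_mx phi ^+ (k * N) *m v' + x').
    (* The exponent [k * N] is at least [N], and the corresponding power is 1 modulo [m]. *)
    by apply: XN => //; apply: leq_pmull.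
  apply: eqmodmxD => //; apply: eqmodmx_trans eqv _.
  by rewrite -{1}[v']mul1mx; apply: eqmodmxM (eqmodmx_sym _) (eqmodmx_refl _ _).
have X0 : X [:: w 0%N] 0.
  exists 0; last exact: eqmodmx_refl.
  by exists 0%N => //; apply/colP=> j; rewrite !mxE.
have XMn x n : X [:: w 0%N] x -> X [:: w 0%N] (x *+ n).
  by move=> Xx; elim: n => [|n IHn] //; rewrite mulrS; apply: XD.
(* [X] is a submonoid of a finite group, and [-y = (m - 1) y] modulo [m]. *)
have XB x y : X [:: w 0%N] x -> X [:: w 0%N] y -> X [:: w 0%N] (x - y).
  move=> Xx Xy; have [z Xz eqz] := XD _ _ _ (XMn _ m.-1 Xy) Xx.
  exists z => //; apply: eqmodmx_trans eqz; exists (- y).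
  rewrite -addrA; congr (x + _).
  rewrite scalerN -[in RHS](intz m) scaler_int -pmulrn -{2}(prednK m0) mulrS.
  by rewrite opprD addrCA subrr addr0.
(* The vector of a return is the difference of two elements of the subgroup [X [:: w 0]]. *)
have X_all v : X [:: w 0%N] v.
  apply: (gen v) => // _ [_ [i1 [i2 [lt_i12 occ1 occ2 _ ->]]] ->].
  rewrite parikh_subword ?(ltnW lt_i12) //; apply: XB;
    by eexists; [eexists; last reflexivity | exact: eqmodmx_refl].
pose x := parikh (subword w 0 i).
have Xx : X u x by exists x; [exists i | exact: eqmodmx_refl].
(* One vector [x] in [X u] suffices: the shift from [x] to the residue [r] lies in [X [:: w 0]]. *)
have [y Xy /eqmodmxP eqy] :=
  XD _ _ _ Xx (X_all (\col_j (r j 0 : nat)%:Z - x)).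
by exists y => // j; rewrite -eqy subrK mxE.
Qed.

Theorem theorem3 (sigma : nat) (phi : seq 'I_sigma -> seq 'I_sigma)
    (w : nat -> 'I_sigma)
    (phi_morph : nonerasing_morphism phi)
    (w_gen : generated_by phi w)
    (w_rec : recurrent w)
    (det_phi : \det (incidence_mx phi) = 1 \/ \det (incidence_mx phi) = -1) :
  welldoc w <-> generates (return_parikh w [:: w 0%N]).
Proof.
split; first exact: welldoc_generates.
exact: generates_welldoc phi_morph w_gen det_phi.
Qed.
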